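(* Let $\mathcal C$ be a rigid monoidal category. If $\mathcal C$ admits a central Hopf monad $\mathfrak D(\mathcal C)$ and an anti-central comodule monad $\mathfrak Q(\mathcal C)$, then $\mathcal C$ is pivotal (i.e. admits a pivotal structure, a monoidal natural isomorphism $\mathrm{Id}_{\mathcal C}\to(-)^{\vee\vee}$) if and only if $\mathfrak D(\mathcal C)\cong\mathfrak Q(\mathcal C)$ as monads on $\mathcal C$.
   Context: Monoidal categories are strict. Rigid means every object $X$ has a left dual $X^\vee$ (with $\mathrm{ev}^l_X\colon X^\vee\otimes X\to1$, $\mathrm{coev}^l_X\colon1\to X\otimes X^\vee$) and a right dual. The double left dual functor $(-)^{\vee\vee}$ is strong monoidal. An endofunctor $T$ of $\mathcal C$ is centralisable if for every $X$ there is a universal extranatural transformation $\zeta_{Y,X}\colon T(Y)^\vee\otimes X\otimes Y\to Z_T(X)$ ($Y\in\mathcal C$), i.e. the coend $Z_T(X)=\int^{Y}T(Y)^\vee\otimes X\otimes Y$ exists. Its centraliser is $(Z_T,\chi)$ with universal coaction $\chi_{X,Y}=(\mathrm{id}_{T(Y)}\otimes\zeta_{Y,X})(\mathrm{coev}^l_{T(Y)}\otimes\mathrm{id}_{X\otimes Y})\colon X\otimes Y\to T(Y)\otimes Z_T(X)$. If $(T,\Delta^{(T)},\varepsilon^{(T)})$ is oplax monoidal, $Z_T$ is a monad with unit $\eta_X=(\varepsilon^{(T)}\otimes\mathrm{id})\chi_{X,1}$ and multiplication the unique natural transformation $\mu$ with $$(\Delta^{(T)}_{Y,W}\otimes\mathrm{id})\chi_{X,Y\otimes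 W}=(\mathrm{id}\otimes\mu_X)(\mathrm{id}_{T(Y)}\otimes\chi_{Z_T(X),W})(\chi_{X,Y}\otimes\mathrm{id}_W).$$ $\mathcal C$ admits a central Hopf monad if $\mathrm{Id}_{\mathcal C}$ is centralisable; $\mathfrak D(\mathcal C)$ is then its centraliser with this monad structure (it carries further Hopf monad structure not needed here). $\mathcal C$ admits an anti-central comodule monad if moreover $(-)^{\vee\vee}$ is centralisable; $\mathfrak Q(\mathcal C)$ is the centraliser of $(-)^{\vee\vee}$ with this monad structure (it carries a further coaction of $\mathfrak D(\mathcal C)$ not needed here). *)

(* Defs.v *)
From Stdlib Require Import Eqdep ClassicalEpsilon.
From mathcomp Require Import ssreflect ssrfun.

Set Implicit Arguments.
Unset Strict Implicit.
Unset Printing Implicit Defensive.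

Declare Scope cat_scope.
Delimit Scope cat_scope with cat.
Local Open Scope cat_scope.

Record category := Category {
  ob :> Type;
  hom : ob -> ob -> Type;
  idm : forall a, hom a a;
  comp : forall a b c, hom b c -> hom a b -> hom a c;
  compA : forall a b c d (h : hom c d) (g : hom b c) (f : hom a b),
    comp h (comp g f) = comp (comp h g) f;
  comp1l : forall a b (f : hom a b), comp (idm b) f = f;
  comp1r : forall a b (f : hom a b), comp f (idm a) = f }.

Arguments hom {_} _ _.
Arguments idm {_} _.
Arguments comp {_ _ _ _} _ _.

Notation "g ∘ f" := (comp g f) (at level 50, left associativity) : cat_scope.

Definition is_iso (C : category) (a b : C) (f : hom a b) : Prop :=
  exists g : hom b a, g ∘ f = idm a /\ f ∘ g = idm b.

(* The identity morphism between two objects that are equal, but possibly only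
   propositionally so. *)
Definition eq_hom (C : category) (a b : C) (e : a = b) : hom a b :=
  match e with erefl => idm a end.
Arguments eq_hom {C a b} e.

Record functor (C D : category) := Functor {
  fob :> C -> D;
  fmap : forall a b, hom a b -> hom (fob a) (fob b);
  fmap_id : forall a, fmap (idm a) = idm (fob a);
  fmap_comp : forall a b c (g : hom b c) (f : hom a b),
    fmap (g ∘ f) = fmap g ∘ fmap f }.
Arguments fmap {_ _} _ {_ _} _.

Record nat_trans (C D : category) (F G : functor C D) := NatTrans {
  nt :> forall a, hom (F a) (G a);
  nt_nat : forall a b (f : hom a b), fmap G f ∘ nt a = nt b ∘ fmap F f }.

Definition id_functor (C : category) : functor C C :=
  @Functor C C (fun a => a) (fun _ _ f => f) (fun _ => erefl)
    (fun _ _ _ _ _ => erefl).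

Record monad (C : category) := Monad {
  mfun :> functor C C;
  eta : forall a, hom a (mfun a);
  mu : forall a, hom (mfun (mfun a)) (mfun a);
  eta_nat : forall a b (f : hom a b), fmap mfun f ∘ eta a = eta b ∘ f;
  mu_nat : forall a b (f : hom a b),
    fmap mfun f ∘ mu a = mu b ∘ fmap mfun (fmap mfun f);
  mu_eta_l : forall a, mu a ∘ eta (mfun a) = idm (mfun a);
  mu_eta_r : forall a, mu a ∘ fmap mfun (eta a) = idm (mfun a);
  mu_assoc : forall a, mu a ∘ mu (mfun a) = mu a ∘ fmap mfun (mu a) }.
Arguments eta {C} m a.
Arguments mu {C} m a.

Record monad_morphism (C : category) (M N : monad C) := MonadMorphism {
  mm :> nat_trans M N;
  mm_eta : forall a, mm a ∘ eta M a = eta N a;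
  mm_mu : forall a, mm a ∘ mu M a = mu N a ∘ (mm (N a) ∘ fmap M (mm a)) }.

Definition monad_isomorphic (C : category) (M N : monad C) : Prop :=
  exists (f : monad_morphism M N) (g : monad_morphism N M),
    forall a, g a ∘ f a = idm (M a) /\ f a ∘ g a = idm (N a).

(* Strictness: the tensor product is associative and unital on the nose on
   objects; on morphisms this is expressed through [eq_hom], since the two
   sides live in hom-types that are only propositionally equal.  The coherence
   axioms then hold because equality proofs are irrelevant. *)
Record strict_monoidal := StrictMonoidal {
  smc :> category;
  unit : smc;
  tens : smc -> smc -> smc;
  tensm : forall a b c d : smc,
    hom a b -> hom c d -> hom (tens a c) (tens b d);
  tensm_id : forall a b, tensm (idm a) (idm b) = idm (tens a b);
  tensm_comp : forall (a b c a' b' c' : smc) (g : hom b c) (f : hom a b)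
      (g' : hom b' c') (f' : hom a' b'),
    tensm (g ∘ f) (g' ∘ f') = tensm g g' ∘ tensm f f';
  tensA : forall a b c, tens a (tens b c) = tens (tens a b) c;
  tens1l : forall a, tens unit a = a;
  tens1r : forall a, tens a unit = a;
  tensmA : forall (a a' b b' c c' : smc)
      (f : hom a a') (g : hom b b') (h : hom c c'),
    eq_hom (tensA a' b' c') ∘ tensm f (tensm g h) =
    tensm (tensm f g) h ∘ eq_hom (tensA a b c);
  tensm1l : forall (a a' : smc) (f : hom a a'),
    eq_hom (tens1l a') ∘ tensm (idm unit) f = f ∘ eq_hom (tens1l a);
  tensm1r : forall (a a' : smc) (f : hom a a'),
    eq_hom (tens1r a') ∘ tensm f (idm unit) = f ∘ eq_hom (tens1r a) }.
Arguments unit {_}.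
Arguments tens {_} _ _.
Arguments tensm {_ _ _ _ _} _ _.

Notation "a ⊗ b" := (tens a b) (at level 40, left associativity) : cat_scope.
Notation "f ⊗' g" := (tensm f g) (at level 40, left associativity) : cat_scope.

Section StructuralIdentities.
Variable C : strict_monoidal.
Implicit Types a b c : C.

Definition assoc a b c : hom (a ⊗ (b ⊗ c)) ((a ⊗ b) ⊗ c) :=
  eq_hom (tensA a b c).
Definition assoc' a b c : hom ((a ⊗ b) ⊗ c) (a ⊗ (b ⊗ c)) :=
  eq_hom (esym (tensA a b c)).
Definition lunit a : hom (unit ⊗ a) a := eq_hom (tens1l a).
Definition lunit' a : hom a (unit ⊗ a) := eq_hom (esym (tens1l a)).
Definition runit a : hom (a ⊗ unit) a := eq_hom (tens1r a).
Definition runit' a : hom a (a ⊗ unit) := eq_hom (esym (tens1r a)).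
End StructuralIdentities.

(* A calculus for equations between morphisms of a strict monoidal category.
   A morphism is replaced by the bundle of its source, its target and itself;
   [None] stands for an undefined composite.  Under [emb] the structural
   identities disappear, and the tensor product becomes strictly associative
   and unital. *)
Section Arrows.
Variable C : strict_monoidal.

Record arrow := Arrow { asrc : C; atgt : C; ahom : hom asrc atgt }.
Definition parrow := option arrow.

Definition emb (a b : C) (f : hom a b) : parrow := Some (Arrow f).

Definition acomp (F G : parrow) : parrow :=
  match F, G with
  | Some (Arrow b' c f), Some (Arrow a b g) =>
    match excluded_middle_informative (b = b') with
    | left e => emb (f ∘ eq_hom e ∘ g)
    | right _ => None
    end
  | _, _ => None
  end.

Definition atens (F G : parrow) : parrow :=
  match F, G with
  | Some (Arrow _ _ f), Some (Arrow _ _ g) => emb (f ⊗' g)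
  | _, _ => None
  end.

Definition aid (a : C) : parrow := emb (idm a).

Local Infix "*" := acomp.
Local Infix "#" := atens (at level 35, right associativity).

Lemma eq_hom_refl (a : C) (e : a = a) : eq_hom e = idm a.
Proof. by rewrite (UIP _ _ _ e erefl). Qed.

Lemma eq_hom_epi (a b c : C) (e : a = b) (f g : hom b c) :
  f ∘ eq_hom e = g ∘ eq_hom e -> f = g.
Proof. by case: b / e f g => f g; rewrite /= !comp1r. Qed.

Lemma eq_hom_trans (a b c : C) (e' : b = c) (e : a = b) :
  eq_hom e' ∘ eq_hom e = eq_hom (etrans e e').
Proof. by case: c / e'; rewrite /= comp1l. Qed.

Lemma emb_eqL (a b c : C) (e : b = c) (f : hom a b) : emb (eq_hom e ∘ f) = emb f.
Proof. by case: c / e; rewrite /= comp1l. Qed.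

Lemma emb_eqR (a b c : C) (e : a = b) (f : hom b c) : emb (f ∘ eq_hom e) = emb f.
Proof. by case: b / e f => f; rewrite /= comp1r. Qed.

Lemma emb_eq (a b : C) (e : a = b) : emb (eq_hom e) = aid a.
Proof. by case: b / e. Qed.

Lemma emb_inj (a b : C) (f g : hom a b) : emb f = emb g -> f = g.
Proof.
move=> /Some_inj E.
pose P (x y : arrow) :=
  exists (p : asrc x = asrc y) (q : atgt x = atgt y),
    eq_hom q ∘ ahom x = ahom y ∘ eq_hom p.
have : P (Arrow f) (Arrow g).
  by rewrite -E; exists erefl, erefl; rewrite /= comp1l comp1r.
by case=> /= p [q]; rewrite !eq_hom_refl comp1l comp1r.
Qed.

Lemma emb_comp (a b c : C) (g : hom b c) (f : hom a b) :
  emb (g ∘ f) = emb g * emb f.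
Proof.
rewrite /emb /=; case: excluded_middle_informative => // e.
by rewrite eq_hom_refl comp1r.
Qed.

Lemma emb_tens (a b c d : C) (f : hom a b) (g : hom c d) :
  emb (f ⊗' g) = emb f # emb g.
Proof. by []. Qed.

Lemma aid_tens (a b : C) : aid (a ⊗ b) = aid a # aid b.
Proof. by rewrite /aid -tensm_id. Qed.

Lemma acompA (F G H : parrow) : F * (G * H) = F * G * H.
Proof.
case: F => [[b2 c f]|] //; case: G => [[b1 b2' g]|] /=; last first.
  by case: H.
case: H => [[a b1' h]|] /=; last by case: excluded_middle_informative.
case: excluded_middle_informative => [e|n]; last first.
  by case: excluded_middle_informative => //= e'; case: excluded_middle_informative.
case: b1 / e g => g /=.
case: excluded_middle_informative => // e; case: b2 / e f => f /=.
case: excluded_middle_informative => // e.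
by rewrite (UIP _ _ _ e erefl) /= !comp1r compA.
Qed.

Lemma atensA (F G H : parrow) : F # (G # H) = (F # G) # H.
Proof.
case: F => [[a a' f]|] //; case: G => [[b b' g]|] //.
case: H => [[c c' h]|] //=.
by rewrite -(emb_eqL (tensA a' b' c')) tensmA emb_eqR.
Qed.

Lemma atens1l (F : parrow) : aid unit # F = F.
Proof.
by case: F => [[a a' f]|] //=; rewrite -(emb_eqL (tens1l a')) tensm1l emb_eqR.
Qed.

Lemma atens1r (F : parrow) : F # aid unit = F.
Proof.
by case: F => [[a a' f]|] //=; rewrite -(emb_eqL (tens1r a')) tensm1r emb_eqR.
Qed.

Lemma exch (a b c d : C) (f : hom a b) (g : hom c d) :
  (emb f # aid d) * (aid a # emb g) = (aid b # emb g) * (emb f # aid c).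
Proof. by rewrite -!emb_tens -!emb_comp -!tensm_comp !comp1l !comp1r. Qed.

Lemma tensm_idl (a b c d : C) (g : hom c d) (f : hom b c) :
  idm a ⊗' (g ∘ f) = (idm a ⊗' g) ∘ (idm a ⊗' f).
Proof. by rewrite -tensm_comp comp1l. Qed.

Lemma tensm_idr (a b c d : C) (g : hom c d) (f : hom b c) :
  (g ∘ f) ⊗' idm a = (g ⊗' idm a) ∘ (f ⊗' idm a).
Proof. by rewrite -tensm_comp comp1l. Qed.

Lemma tensm_eql (a b c : C) (e : b = c) :
  idm a ⊗' eq_hom e = eq_hom (f_equal (tens a) e).
Proof. by case: c / e; rewrite /= tensm_id. Qed.

Lemma tensm_eqr (a b c : C) (e : b = c) :
  eq_hom e ⊗' idm a = eq_hom (f_equal (fun x => tens x a) e).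
Proof. by case: c / e; rewrite /= tensm_id. Qed.

Lemma tensm_split (a b c d : C) (f : hom a b) (g : hom c d) :
  f ⊗' g = (f ⊗' idm d) ∘ (idm a ⊗' g).
Proof. by rewrite -tensm_comp comp1l comp1r. Qed.

Lemma tensm_split' (a b c d : C) (f : hom a b) (g : hom c d) :
  f ⊗' g = (idm b ⊗' g) ∘ (f ⊗' idm c).
Proof. by rewrite -tensm_comp comp1l comp1r. Qed.

Definition is_arr (F : parrow) (a b : C) := exists f : hom a b, F = emb f.

Lemma is_emb (a b : C) (f : hom a b) : is_arr (emb f) a b.
Proof. by exists f. Qed.

Lemma is_tens F G (a b c d : C) :
  is_arr F a b -> is_arr G c d -> is_arr (F # G) (a ⊗ c) (b ⊗ d).
Proof. by move=> [f ->] [g ->]; exists (f ⊗' g). Qed.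

Lemma is_comp F G (a b b' c : C) :
  is_arr F b c -> is_arr G a b' -> b' = b -> is_arr (F * G) a c.
Proof.
by move=> [f ->] [g ->] e; case: b / e f => f; exists (f ∘ g); rewrite emb_comp.
Qed.

Lemma is_cast F (a a' b b' : C) :
  is_arr F a b -> a = a' -> b = b' -> is_arr F a' b'.
Proof. by move=> H <- <-. Qed.

Lemma acomp1l F (b : C) : (exists a, is_arr F a b) -> aid b * F = F.
Proof. by move=> [a [f ->]]; rewrite -emb_comp comp1l. Qed.

Lemma acomp1r F (a : C) : (exists b, is_arr F a b) -> F * aid a = F.
Proof. by move=> [b [f ->]]; rewrite -emb_comp comp1r. Qed.

End Arrows.

Notation "F *c G" := (acomp F G) (at level 40, left associativity).
Notation "F #c G" := (atens F G) (at level 35, right associativity).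

Lemma emb_idm (C : strict_monoidal) (a : C) : emb (idm a) = aid a.
Proof. by []. Qed.

Ltac obj_eq := by rewrite /= ?tens1l ?tens1r ?tensA.
Ltac is_arr_tac :=
  eexists; eapply is_cast;
  [ repeat first [eapply is_comp | eapply is_tens | exact: (is_emb (idm _))
                 | eapply is_emb]; try obj_eq
  | first [reflexivity | obj_eq] | first [reflexivity | obj_eq] ].

(* [norm] pushes [emb] through a morphism expression in the goal and puts the
   result in normal form; [norm_in E] does the same in the hypothesis [E]. *)
Ltac norm :=
  rewrite /assoc /assoc' /lunit /lunit' /runit /runit';
  rewrite ?(tensm_idl, tensm_idr, comp1l, comp1r, tensm_id, tensm_eql, tensm_eqr,
    compA, eq_hom_trans);
  rewrite ?(emb_eqL, emb_eqR);
  rewrite ?(emb_eqL, emb_eqR, emb_comp);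
  rewrite ?(emb_tens, emb_eq, emb_idm);
  rewrite ?aid_tens -?atensA ?atens1l ?atens1r -?acompA.
Ltac norm_in E := revert E; norm; move=> E.

(* Rewriting with an equation between composites inside a longer composite *)
Lemma acomp_ctx (C : strict_monoidal) (F G H : parrow C) :
  F *c G = H -> forall R, F *c (G *c R) = H *c R.
Proof. by move=> <- R; rewrite acompA. Qed.

Lemma acomp_ctx3 (C : strict_monoidal) (F G H K : parrow C) :
  F *c (G *c H) = K -> forall R, F *c (G *c (H *c R)) = K *c R.
Proof. by move=> <- R; rewrite !acompA. Qed.

Ltac rew E := first [rewrite (acomp_ctx3 E) | rewrite (acomp_ctx E) | rewrite E]; rewrite -?acompA.
Ltac slide f g := let E := fresh in have E := exch f g; norm_in E; rew E; clear E.
Ltac slideV f g :=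
  let E := fresh in have E := esym (exch f g); norm_in E; rew E; clear E.

Ltac whisk a b E :=
  let W := fresh in
  have W := f_equal (fun k => emb (idm a ⊗' (k ⊗' idm b))) E; norm_in W;
  rew W; clear W.
Ltac idl := rewrite -?aid_tens acomp1l; [rewrite ?aid_tens -?atensA | by is_arr_tac].
Ltac idr := rewrite -?aid_tens acomp1r; [rewrite ?aid_tens -?atensA | by is_arr_tac].

(* A duality between X and X': X' is a left dual of X, X is a right dual of X'. *)
Record dual_pair (C : strict_monoidal) (X X' : C) := DualPair {
  coev : hom unit (X ⊗ X');
  ev : hom (X' ⊗ X) unit;
  zigzagl : runit X ∘ (idm X ⊗' ev) ∘ assoc' X X' X ∘ (coev ⊗' idm X) ∘ lunit' X
            = idm X;
  zigzagr : lunit X' ∘ (ev ⊗' idm X') ∘ assoc X' X X' ∘ (idm X' ⊗' coev)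
              ∘ runit' X' = idm X' }.

Section Mates.
Variable C : strict_monoidal.

Lemma zigl (X X' : C) (p : dual_pair X X') :
  (aid X #c emb (ev p)) *c (emb (coev p) #c aid X) = aid X.
Proof. by have := f_equal (@emb _ _ _) (zigzagl p); norm. Qed.

Lemma zigr (X X' : C) (p : dual_pair X X') :
  (emb (ev p) #c aid X') *c (aid X' #c emb (coev p)) = aid X'.
Proof. by have := f_equal (@emb _ _ _) (zigzagr p); norm. Qed.

Definition tens_coev (X X' Y Y' : C) (p : dual_pair X X') (q : dual_pair Y Y') :
    hom unit ((X ⊗ Y) ⊗ (Y' ⊗ X')) :=
  assoc X Y (Y' ⊗ X') ∘ (idm X ⊗' (assoc' Y Y' X' ∘ (coev q ⊗' idm X') ∘ lunit' X'))
    ∘ coev p.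

Definition tens_ev (X X' Y Y' : C) (p : dual_pair X X') (q : dual_pair Y Y') :
    hom ((Y' ⊗ X') ⊗ (X ⊗ Y)) unit :=
  ev q ∘ (idm Y' ⊗' (lunit Y ∘ (ev p ⊗' idm Y) ∘ assoc X' X Y))
    ∘ assoc' Y' X' (X ⊗ Y).

Lemma tens_zigl (X X' Y Y' : C) (p : dual_pair X X') (q : dual_pair Y Y') :
  runit _ ∘ (idm (X ⊗ Y) ⊗' tens_ev p q) ∘ assoc' _ _ _ ∘ (tens_coev p q ⊗' idm _)
    ∘ lunit' _ = idm (X ⊗ Y).
Proof.
apply: emb_inj; rewrite /tens_ev /tens_coev; norm.
slideV (idm X ⊗' coev q) (ev p ⊗' idm Y).
whisk (@unit C) Y (zigzagl p).
whisk X (@unit C) (zigzagl q).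
by idl.
Qed.

Lemma tens_zigr (X X' Y Y' : C) (p : dual_pair X X') (q : dual_pair Y Y') :
  lunit _ ∘ (tens_ev p q ⊗' idm _) ∘ assoc _ _ _ ∘ (idm _ ⊗' tens_coev p q)
    ∘ runit' _ = idm (Y' ⊗ X').
Proof.
apply: emb_inj; rewrite /tens_ev /tens_coev; norm.
slide (idm Y' ⊗' ev p) (coev q ⊗' idm X').
whisk Y' (@unit C) (zigzagr p).
idr.
by whisk (@unit C) X' (zigzagr q).
Qed.

Definition tens_dual_pair (X X' Y Y' : C) (p : dual_pair X X') (q : dual_pair Y Y') :
    dual_pair (X ⊗ Y) (Y' ⊗ X') :=
  DualPair (tens_zigl p q) (tens_zigr p q).

Lemma unit_zigl :
  runit _ ∘ (idm unit ⊗' lunit unit) ∘ assoc' _ _ _ ∘ (lunit' unit ⊗' idm _)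
    ∘ lunit' _ = idm (@unit C).
Proof. by apply: emb_inj; norm. Qed.

Lemma unit_zigr :
  lunit _ ∘ (lunit unit ⊗' idm _) ∘ assoc _ _ _ ∘ (idm _ ⊗' lunit' unit)
    ∘ runit' _ = idm (@unit C).
Proof. by apply: emb_inj; norm. Qed.

Definition unit_dual_pair : dual_pair unit unit := DualPair unit_zigl unit_zigr.

(* The morphism dual to [f], for arbitrary choices of duals.  Here and below
   [locked] only prevents unfolding during rewriting. *)
Definition mate (X X' Y Y' : C) (p : dual_pair X X') (q : dual_pair Y Y')
    (f : hom X Y) : hom Y' X' :=
  locked (lunit X' ∘ (ev q ⊗' idm X') ∘ ((idm Y' ⊗' f) ⊗' idm X') ∘ assoc Y' X X'
    ∘ (idm Y' ⊗' coev p) ∘ runit' Y').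

Lemma mate_ev (X X' Y Y' : C) (p : dual_pair X X') (q : dual_pair Y Y')
    (f : hom X Y) :
  ev p ∘ (mate p q f ⊗' idm X) = ev q ∘ (idm Y' ⊗' f).
Proof.
apply: emb_inj; rewrite /mate -lock; norm.
slideV (ev q) (ev p).
slideV (idm Y' ⊗' f) (ev p).
whisk Y' (@unit C) (zigzagl p).
by idr.
Qed.

Lemma mate_uniq (X X' Y Y' : C) (p : dual_pair X X') (q : dual_pair Y Y')
    (f : hom X Y) (g : hom Y' X') :
  ev p ∘ (g ⊗' idm X) = ev q ∘ (idm Y' ⊗' f) -> g = mate p q f.
Proof.
move=> E; apply: emb_inj; rewrite /mate -lock; norm.
whisk (@unit C) X' (esym E).
slide g (coev p).
whisk (@unit C) (@unit C) (zigzagr p).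
by idl.
Qed.

Lemma mate_coev (X X' Y Y' : C) (p : dual_pair X X') (q : dual_pair Y Y')
    (f : hom X Y) :
  (f ⊗' idm X') ∘ coev p = (idm Y ⊗' mate p q f) ∘ coev q.
Proof.
apply: emb_inj; rewrite /mate -lock; norm.
slideV (coev q) (coev p).
slideV (coev q) (f ⊗' idm X').
whisk (@unit C) X' (zigzagl q).
by idl.
Qed.

Lemma mate_id (X X' : C) (p : dual_pair X X') : mate p p (idm X) = idm X'.
Proof. by apply: esym; apply: mate_uniq. Qed.

Lemma mate_comp (X X' Y Y' Z Z' : C) (p : dual_pair X X') (q : dual_pair Y Y')
    (r : dual_pair Z Z') (g : hom Y Z) (f : hom X Y) :
  mate p r (g ∘ f) = mate p q f ∘ mate q r g.
Proof.
apply: esym; apply: mate_uniq.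
rewrite tensm_idr compA mate_ev -compA -tensm_comp comp1l comp1r.
rewrite tensm_idl compA -(mate_ev q r g) -compA -tensm_comp comp1l comp1r //.
Qed.

Lemma mate_tens (X X' Y Y' Z Z' W W' : C) (p : dual_pair X X')
    (q : dual_pair Y Y') (r : dual_pair Z Z') (s : dual_pair W W')
    (f : hom X Y) (g : hom Z W) :
  mate (tens_dual_pair p r) (tens_dual_pair q s) (f ⊗' g) =
  mate r s g ⊗' mate p q f.
Proof.
apply: esym; apply: mate_uniq; apply: emb_inj.
rewrite /= /tens_ev (tensm_split' (mate r s g)) (tensm_split' f g); norm.
whisk Z' Z (mate_ev p q f).
slideV (mate r s g) ((idm Y' ⊗' f) ⊗' idm Z).
slideV (mate r s g) (ev q ⊗' idm Z).
whisk (@unit C) (@unit C) (mate_ev r s g).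
by slide (idm W' ⊗' ev q) g.
Qed.

Lemma mate_assoc (X X' Y Y' Z Z' : C) (p : dual_pair X X') (q : dual_pair Y Y')
    (r : dual_pair Z Z') :
  mate (tens_dual_pair p (tens_dual_pair q r))
       (tens_dual_pair (tens_dual_pair p q) r) (assoc X Y Z) = assoc Z' Y' X'.
Proof.
apply: esym; apply: mate_uniq; apply: emb_inj.
by rewrite /= /tens_ev /= /tens_ev; norm.
Qed.

Lemma mate_assoc' (X X' Y Y' Z Z' : C) (p : dual_pair X X') (q : dual_pair Y Y')
    (r : dual_pair Z Z') :
  mate (tens_dual_pair (tens_dual_pair p q) r)
       (tens_dual_pair p (tens_dual_pair q r)) (assoc' X Y Z) = assoc' Z' Y' X'.
Proof.
apply: esym; apply: mate_uniq; apply: emb_inj.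
by rewrite /= /tens_ev /= /tens_ev; norm.
Qed.

Lemma mate_lunit (X X' : C) (p : dual_pair X X') :
  mate (tens_dual_pair unit_dual_pair p) p (lunit X) = runit' X'.
Proof.
apply: esym; apply: mate_uniq; apply: emb_inj.
by rewrite /= /tens_ev /= /tens_ev; norm.
Qed.

Lemma mate_runit (X X' : C) (p : dual_pair X X') :
  mate (tens_dual_pair p unit_dual_pair) p (runit X) = lunit' X'.
Proof.
apply: esym; apply: mate_uniq; apply: emb_inj.
by rewrite /= /tens_ev /= /tens_ev; norm.
Qed.

Lemma mate_lunit' (X X' : C) (p : dual_pair X X') :
  mate p (tens_dual_pair unit_dual_pair p) (lunit' X) = runit X'.
Proof.
apply: esym; apply: mate_uniq; apply: emb_inj.
by rewrite /= /tens_ev /= /tens_ev; norm.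
Qed.

Lemma mate_runit' (X X' : C) (p : dual_pair X X') :
  mate p (tens_dual_pair p unit_dual_pair) (runit' X) = lunit X'.
Proof.
apply: esym; apply: mate_uniq; apply: emb_inj.
by rewrite /= /tens_ev /= /tens_ev; norm.
Qed.
End Mates.

(* Duals are chosen: [ldual X] is a left dual and [rdual X] a right dual. *)
Record rigid (C : strict_monoidal) := Rigid {
  ldual : C -> C;
  rdual : C -> C;
  ldual_pair : forall X, dual_pair X (ldual X);
  rdual_pair : forall X, dual_pair (rdual X) X }.

(* Oplax monoidal endofunctors *)
Record oplax_functor (C : strict_monoidal) := OplaxFunctor {
  ofun :> functor C C;
  delta : forall X Y, hom (ofun (X ⊗ Y)) (ofun X ⊗ ofun Y);
  epsilon : hom (ofun unit) unit;
  delta_nat : forall (X X' Y Y' : C) (f : hom X X') (g : hom Y Y'),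
    delta X' Y' ∘ fmap ofun (f ⊗' g) = (fmap ofun f ⊗' fmap ofun g) ∘ delta X Y;
  delta_assoc : forall X Y Z,
    assoc _ _ _ ∘ (idm (ofun X) ⊗' delta Y Z) ∘ delta X (Y ⊗ Z) =
    (delta X Y ⊗' idm (ofun Z)) ∘ delta (X ⊗ Y) Z ∘ fmap ofun (assoc X Y Z);
  delta_epsilon_l : forall X,
    lunit _ ∘ (epsilon ⊗' idm (ofun X)) ∘ delta unit X = fmap ofun (lunit X);
  delta_epsilon_r : forall X,
    runit _ ∘ (idm (ofun X) ⊗' epsilon) ∘ delta X unit = fmap ofun (runit X) }.
Arguments delta {_} _ _ _.
Arguments epsilon {_} _.

(* A strong monoidal functor is an oplax one with invertible structure maps. *)
Definition is_strong (C : strict_monoidal) (T : oplax_functor C) : Prop :=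
  (forall X Y, is_iso (delta T X Y)) /\ is_iso (epsilon T).

(* On strong monoidal functors these are the monoidal natural transformations. *)
Definition is_monoidal (C : strict_monoidal) (S T : oplax_functor C)
    (phi : nat_trans S T) : Prop :=
  (forall X Y, delta T X Y ∘ phi (X ⊗ Y) = (phi X ⊗' phi Y) ∘ delta S X Y) /\
  epsilon T ∘ phi unit = epsilon S.

Definition id_oplax (C : strict_monoidal) : oplax_functor C.
Proof.
refine (@OplaxFunctor C (id_functor C) (fun X Y => idm (X ⊗ Y)) (idm unit) _ _ _ _);
  by move=> *; rewrite /= ?tensm_id ?comp1l ?comp1r.
Defined.

Section DoubleDual.
Variables (C : strict_monoidal) (R : rigid C).

Local Notation "X ^v" := (ldual R X) (at level 2, format "X ^v").
Local Notation pr := (ldual_pair R).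

Definition dual_map (X Y : C) (f : hom X Y) : hom Y^v X^v :=
  mate (pr X) (pr Y) f.

Lemma dual_map_id X : dual_map (idm X) = idm X^v.
Proof. exact: mate_id. Qed.

Lemma dual_map_comp (X Y Z : C) (g : hom Y Z) (f : hom X Y) :
  dual_map (g ∘ f) = dual_map f ∘ dual_map g.
Proof. exact: mate_comp. Qed.

Definition double_dual_functor : functor C C.
Proof.
refine (@Functor C C (fun X => X^v^v)
  (fun X Y (f : hom X Y) => dual_map (dual_map f)) _ _).
- by move=> X; rewrite !dual_map_id.
- by move=> X Y Z g f; rewrite !dual_map_comp.
Defined.

(* The canonical comparison morphisms between two duals of the same object *)
Definition dual_tens (X Y : C) : hom (Y^v ⊗ X^v) (X ⊗ Y)^v :=
  mate (pr (X ⊗ Y)) (tens_dual_pair (pr X) (pr Y)) (idm (X ⊗ Y)).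

Definition dual_tens' (X Y : C) : hom (X ⊗ Y)^v (Y^v ⊗ X^v) :=
  mate (tens_dual_pair (pr X) (pr Y)) (pr (X ⊗ Y)) (idm (X ⊗ Y)).

Definition dual_unit : hom unit unit^v :=
  mate (pr unit) (unit_dual_pair C) (idm unit).

Definition dual_unit' : hom unit^v unit :=
  mate (unit_dual_pair C) (pr unit) (idm unit).

Definition double_dual_delta (X Y : C) : hom (X ⊗ Y)^v^v (X^v^v ⊗ Y^v^v) :=
  mate (tens_dual_pair (pr Y^v) (pr X^v)) (pr (X ⊗ Y)^v) (dual_tens X Y).

Definition double_dual_epsilon : hom unit^v^v unit :=
  mate (unit_dual_pair C) (pr unit^v) dual_unit.

Lemma double_dual_delta_nat (X X' Y Y' : C) (f : hom X X') (g : hom Y Y') :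
  double_dual_delta X' Y' ∘ dual_map (dual_map (f ⊗' g)) =
  (dual_map (dual_map f) ⊗' dual_map (dual_map g)) ∘ double_dual_delta X Y.
Proof.
rewrite /double_dual_delta /dual_map -mate_tens -!mate_comp; congr mate.
by rewrite /dual_tens -mate_tens -!mate_comp comp1l comp1r.
Qed.

Lemma double_dual_assoc (X Y Z : C) :
  assoc _ _ _ ∘ (idm X^v^v ⊗' double_dual_delta Y Z) ∘ double_dual_delta X (Y ⊗ Z) =
  (double_dual_delta X Y ⊗' idm Z^v^v) ∘ double_dual_delta (X ⊗ Y) Z
    ∘ dual_map (dual_map (assoc X Y Z)).
Proof.
rewrite -(mate_id (pr X^v)) -(mate_id (pr Z^v)).
rewrite /double_dual_delta /dual_map -!mate_tens -(mate_assoc (pr Z^v) (pr Y^v) (pr X^v)).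
rewrite -!mate_comp; congr mate.
rewrite /dual_tens -(mate_id (pr X)) -(mate_id (pr Z)) -!mate_tens.
rewrite -(mate_assoc (pr X) (pr Y) (pr Z)) -!mate_comp.
by rewrite !tensm_id !(comp1l, comp1r).
Qed.

Lemma double_dual_epsilon_l (X : C) :
  lunit _ ∘ (double_dual_epsilon ⊗' idm X^v^v) ∘ double_dual_delta unit X =
  dual_map (dual_map (lunit X)).
Proof.
rewrite -(mate_id (pr X^v)).
rewrite /double_dual_delta /double_dual_epsilon /dual_map -!mate_tens.
rewrite -(mate_runit' (pr X^v)) -!mate_comp; congr mate.
rewrite /dual_tens /dual_unit -(mate_id (pr X)) -!mate_tens.
rewrite -(mate_lunit (pr X)) -!mate_comp.
by rewrite !tensm_id !(comp1l, comp1r).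
Qed.

Lemma double_dual_epsilon_r (X : C) :
  runit _ ∘ (idm X^v^v ⊗' double_dual_epsilon) ∘ double_dual_delta X unit =
  dual_map (dual_map (runit X)).
Proof.
rewrite -(mate_id (pr X^v)).
rewrite /double_dual_delta /double_dual_epsilon /dual_map -!mate_tens.
rewrite -(mate_lunit' (pr X^v)) -!mate_comp; congr mate.
rewrite /dual_tens /dual_unit -(mate_id (pr X)) -!mate_tens.
rewrite -(mate_runit (pr X)) -!mate_comp.
by rewrite !tensm_id !(comp1l, comp1r).
Qed.

Definition double_dual : oplax_functor C :=
  @OplaxFunctor C double_dual_functor double_dual_delta double_dual_epsilon
    double_dual_delta_nat double_dual_assoc double_dual_epsilon_l
    double_dual_epsilon_r.

Lemma double_dual_strong : is_strong double_dual.
Proof.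
split=> [X Y|].
- exists (mate (pr (X ⊗ Y)^v) (tens_dual_pair (pr Y^v) (pr X^v)) (dual_tens' X Y)).
  by rewrite /= /double_dual_delta -!mate_comp /dual_tens /dual_tens' -?mate_comp !comp1l !mate_id.
- exists (mate (pr unit^v) (unit_dual_pair C) dual_unit').
  by rewrite /= /double_dual_epsilon -!mate_comp /dual_unit /dual_unit' -?mate_comp !comp1l !mate_id.
Qed.

Definition pivotal : Prop :=
  exists phi : nat_trans (id_oplax C) double_dual,
    is_monoidal phi /\ forall X, is_iso (phi X).

End DoubleDual.

Section Centraliser.
Variables (C : strict_monoidal) (R : rigid C).

Local Notation "X ^v" := (ldual R X) (at level 2, format "X ^v").
Local Notation pr := (ldual_pair R).

Definition extranatural (T : functor C C) (X M : C)
    (xi : forall Y, hom ((T Y)^v ⊗ (X ⊗ Y)) M) : Prop :=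
  forall (Y Y' : C) (f : hom Y Y'),
    xi Y ∘ (dual_map R (fmap T f) ⊗' (idm X ⊗' idm Y)) =
    xi Y' ∘ (idm (T Y')^v ⊗' (idm X ⊗' f)).

(* For every X, a coend of the functor (Y', Y) |-> T(Y')^v ⊗ X ⊗ Y. *)
Record centralisable (T : functor C C) := Centralisable {
  cz : C -> C;
  zeta : forall X Y, hom ((T Y)^v ⊗ (X ⊗ Y)) (cz X);
  zeta_extranatural : forall X, extranatural (zeta X);
  cz_desc : forall (X M : C) (xi : forall Y, hom ((T Y)^v ⊗ (X ⊗ Y)) M),
    extranatural xi -> hom (cz X) M;
  cz_fac : forall (X M : C) (xi : forall Y, hom ((T Y)^v ⊗ (X ⊗ Y)) M)
    (xiP : extranatural xi) Y, cz_desc xiP ∘ zeta X Y = xi Y;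
  cz_uniq : forall (X M : C) (xi : forall Y, hom ((T Y)^v ⊗ (X ⊗ Y)) M)
    (xiP : extranatural xi) (h : hom (cz X) M),
    (forall Y, h ∘ zeta X Y = xi Y) -> h = cz_desc xiP }.

Section Coaction.
Variables (T : functor C C) (Z : centralisable T).

(* The universal coaction *)
Definition chi (X Y : C) : hom (X ⊗ Y) (T Y ⊗ cz Z X) :=
  locked ((idm (T Y) ⊗' zeta Z X Y) ∘ assoc' _ _ _
            ∘ (coev (pr (T Y)) ⊗' idm (X ⊗ Y)) ∘ lunit' _).

Definition uncurry (X M : C) (phi : forall Y, hom (X ⊗ Y) (T Y ⊗ M)) Y :
    hom ((T Y)^v ⊗ (X ⊗ Y)) M :=
  lunit M ∘ (ev (pr (T Y)) ⊗' idm M) ∘ assoc _ _ _ ∘ (idm (T Y)^v ⊗' phi Y).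

Lemma chi_zeta X Y : uncurry (chi X) Y = zeta Z X Y.
Proof.
apply: emb_inj; rewrite /uncurry /chi -lock; norm.
slide (ev (pr (T Y))) (zeta Z X Y).
whisk (@unit C) (X ⊗ Y) (zigzagr (pr (T Y))).
by idr.
Qed.

Definition coaction_natural (X M : C) (phi : forall Y, hom (X ⊗ Y) (T Y ⊗ M)) :=
  forall (Y Y' : C) (f : hom Y Y'),
    (fmap T f ⊗' idm M) ∘ phi Y = phi Y' ∘ (idm X ⊗' f).

Lemma chi_natr X : coaction_natural (chi X).
Proof.
move=> Y Y' f; apply: emb_inj; rewrite /chi -!lock; norm.
slide (fmap T f) (zeta Z X Y).
whisk (@unit C) (X ⊗ Y) (mate_coev (pr (T Y)) (pr (T Y')) (fmap T f)).
whisk (T Y') (@unit C) (zeta_extranatural Z X f).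
by slideV (coev (pr (T Y'))) (idm X ⊗' f).
Qed.

Lemma chi_ext (X M : C) (h h' : hom (cz Z X) M) :
  (forall Y, (idm (T Y) ⊗' h) ∘ chi X Y = (idm (T Y) ⊗' h') ∘ chi X Y) -> h = h'.
Proof.
move=> E; pose xi Y := h ∘ zeta Z X Y.
have xiP : extranatural xi.
  by move=> Y Y' f; rewrite /xi -!compA zeta_extranatural.
rewrite (cz_uniq xiP (h := h)) // (cz_uniq xiP (h := h')) // => Y.
apply: emb_inj; rewrite /xi -chi_zeta /uncurry; norm.
slideV (ev (pr (T Y))) h'; slideV (ev (pr (T Y))) h.
by whisk ((T Y)^v) (@unit C) (E Y).
Qed.

Lemma uncurry_extranatural (X M : C) (phi : forall Y, hom (X ⊗ Y) (T Y ⊗ M)) :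
  coaction_natural phi -> extranatural (uncurry phi).
Proof.
move=> phiP Y Y' f; apply: emb_inj; rewrite /uncurry; norm.
whisk ((T Y')^v) (@unit C) (esym (phiP _ _ f)).
whisk (@unit C) M (esym (mate_ev (pr (T Y)) (pr (T Y')) (fmap T f))).
by slide (dual_map R (fmap T f)) (phi Y).
Qed.

Definition lift (X M : C) (phi : forall Y, hom (X ⊗ Y) (T Y ⊗ M))
    (phiP : coaction_natural phi) : hom (cz Z X) M :=
  cz_desc Z (uncurry_extranatural phiP).

Lemma chi_lift (X M : C) (phi : forall Y, hom (X ⊗ Y) (T Y ⊗ M))
    (phiP : coaction_natural phi) Y :
  (idm (T Y) ⊗' lift phiP) ∘ chi X Y = phi Y.
Proof.
apply: emb_inj; rewrite /chi -!lock; norm.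
whisk (T Y) (@unit C) (cz_fac Z (uncurry_extranatural phiP) Y).
rewrite /uncurry; norm.
slideV (coev (pr (T Y))) (phi Y).
whisk (@unit C) M (zigzagl (pr (T Y))).
by idl.
Qed.

(* Tensoring on the right with an object preserves the universal property. *)
Lemma chi_ext2 (X W M : C) (h h' : hom (cz Z X ⊗ W) M) :
  (forall Y, (idm (T Y) ⊗' h) ∘ assoc' _ _ _ ∘ (chi X Y ⊗' idm W) =
             (idm (T Y) ⊗' h') ∘ assoc' _ _ _ ∘ (chi X Y ⊗' idm W)) ->
  h = h'.
Proof.
move=> E.
pose k (l : hom (cz Z X ⊗ W) M) : hom (cz Z X) (M ⊗ W^v) :=
  (l ⊗' idm W^v) ∘ assoc _ _ _ ∘ (idm (cz Z X) ⊗' coev (pr W)) ∘ runit' _.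
have kK l : l = runit M ∘ (idm M ⊗' ev (pr W)) ∘ assoc' _ _ _ ∘ (k l ⊗' idm W).
  apply: emb_inj; rewrite /k; norm.
  slideV l (ev (pr W)).
  whisk (cz Z X) (@unit C) (zigzagl (pr W)).
  by idr.
rewrite (kK h) (kK h'); congr (_ ∘ (_ ⊗' _)); apply: chi_ext => Y.
apply: emb_inj; rewrite /k; norm.
slideV (chi X Y) (coev (pr W)).
whisk (@unit C) (W^v) (E Y).
by slide (chi X Y) (coev (pr W)).
Qed.

Section Lift2.
Variables (X W M : C) (phi : forall Y, hom (X ⊗ (Y ⊗ W)) (T Y ⊗ M)).
Hypothesis phiP : forall (Y Y' : C) (f : hom Y Y'),
  (fmap T f ⊗' idm M) ∘ phi Y = phi Y' ∘ (idm X ⊗' (f ⊗' idm W)).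

Definition lift2_aux Y : hom (X ⊗ Y) (T Y ⊗ (M ⊗ W^v)) :=
  assoc' _ _ _ ∘ (phi Y ⊗' idm W^v) ∘ assoc _ _ _ ∘ (idm X ⊗' assoc _ _ _)
    ∘ (idm X ⊗' (idm Y ⊗' coev (pr W))) ∘ (idm X ⊗' runit' _).

Lemma lift2_auxP : coaction_natural lift2_aux.
Proof.
move=> Y Y' f; apply: emb_inj; rewrite /lift2_aux; norm.
whisk (@unit C) (W^v) (phiP f).
by slide (idm X ⊗' f) (coev (pr W)).
Qed.

Definition lift2 : hom (cz Z X ⊗ W) M :=
  locked (runit M ∘ (idm M ⊗' ev (pr W)) ∘ assoc' _ _ _ ∘ (lift lift2_auxP ⊗' idm W)).

Lemma chi_lift2 Y :
  (idm (T Y) ⊗' lift2) ∘ assoc' _ _ _ ∘ (chi X Y ⊗' idm W) ∘ assoc _ _ _ = phi Y.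
Proof.
apply: emb_inj; rewrite /lift2 -lock; norm.
whisk (@unit C) W (chi_lift lift2_auxP Y).
rewrite /lift2_aux; norm.
slideV (phi Y) (ev (pr W)).
whisk (X ⊗ Y) (@unit C) (zigzagl (pr W)).
by idr.
Qed.
End Lift2.

Lemma cz_map_natural (X X' : C) (f : hom X X') :
  coaction_natural (fun Y => chi X' Y ∘ (f ⊗' idm Y)).
Proof.
move=> Y Y' g; rewrite compA chi_natr -!compA -!tensm_comp.
by rewrite !(comp1l, comp1r).
Qed.

Definition cz_map (X X' : C) (f : hom X X') : hom (cz Z X) (cz Z X') :=
  lift (cz_map_natural f).

Lemma chi_natl (X X' : C) (f : hom X X') Y :
  (idm (T Y) ⊗' cz_map f) ∘ chi X Y = chi X' Y ∘ (f ⊗' idm Y).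
Proof. exact: chi_lift. Qed.

(* The functor structure on Z_T making the coaction natural in X *)
Definition centraliser_functor : functor C C.
Proof.
refine (@Functor C C (cz Z) cz_map _ _).
- move=> X; apply: chi_ext => Y.
  by rewrite chi_natl !tensm_id comp1l comp1r.
- move=> X X' X'' g f; apply: chi_ext => Y.
  by rewrite chi_natl tensm_idr tensm_idl -[RHS]compA chi_natl [RHS]compA chi_natl !compA.
Defined.

End Coaction.

Section CentraliserMonad.
Variables (T : oplax_functor C) (Z : centralisable T).

Local Notation ZT := (centraliser_functor Z).

Definition centraliser_eta (X : C) : hom X (cz Z X) :=
  locked (lunit _ ∘ (epsilon T ⊗' idm (cz Z X)) ∘ chi Z X unit ∘ runit' X).

Lemma mu_aux_natural (X W : C) (Y Y' : C) (f : hom Y Y') :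
  (fmap T f ⊗' idm (T W ⊗ cz Z X)) ∘
    (assoc' _ _ _ ∘ (delta T Y W ⊗' idm _) ∘ chi Z X (Y ⊗ W)) =
  assoc' _ _ _ ∘ (delta T Y' W ⊗' idm _) ∘ chi Z X (Y' ⊗ W)
    ∘ (idm X ⊗' (f ⊗' idm W)).
Proof.
apply: emb_inj; norm.
have D := delta_nat T f (idm W); rewrite fmap_id in D.
whisk (@unit C) (cz Z X) (esym D).
by whisk (@unit C) (@unit C) (chi_natr Z X (f ⊗' idm W)).
Qed.

Definition mu_aux (X W : C) : hom (cz Z X ⊗ W) (T W ⊗ cz Z X) :=
  lift2 Z (@mu_aux_natural X W).

Lemma chi_mu_aux (X Y W : C) :
  (idm (T Y) ⊗' mu_aux X W) ∘ assoc' _ _ _ ∘ (chi Z X Y ⊗' idm W) ∘ assoc _ _ _ =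
  assoc' _ _ _ ∘ (delta T Y W ⊗' idm _) ∘ chi Z X (Y ⊗ W).
Proof. exact: chi_lift2. Qed.

Lemma mu_auxP (X : C) : coaction_natural (mu_aux X).
Proof.
move=> W W' f; apply: chi_ext2 => Y; apply: emb_inj; norm.
whisk (@unit C) (@unit C) (chi_mu_aux X Y W).
slideV (chi Z X Y) f.
whisk (@unit C) (@unit C) (chi_mu_aux X Y W').
have D := delta_nat T (idm Y) f; rewrite fmap_id in D.
whisk (@unit C) (cz Z X) (esym D).
by whisk (@unit C) (@unit C) (chi_natr Z X (idm Y ⊗' f)).
Qed.

(* Determined by its defining equation: see [centraliser_muE] and
   [centraliser_mu_uniq]. *)
Definition centraliser_mu (X : C) : hom (cz Z (cz Z X)) (cz Z X) := lift Z (mu_auxP X).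

Lemma centraliser_muE (X Y W : C) :
  (delta T Y W ⊗' idm (cz Z X)) ∘ chi Z X (Y ⊗ W) =
  (idm (T Y ⊗ T W) ⊗' centraliser_mu X) ∘ assoc _ _ _
    ∘ (idm (T Y) ⊗' chi Z (cz Z X) W) ∘ assoc' _ _ _ ∘ (chi Z X Y ⊗' idm W)
    ∘ assoc _ _ _.
Proof.
apply: emb_inj; norm.
whisk (T Y) (@unit C) (chi_lift Z (mu_auxP X) W).
by whisk (@unit C) (@unit C) (chi_mu_aux X Y W).
Qed.

Lemma centraliser_mu_uniq (m : forall X, hom (cz Z (cz Z X)) (cz Z X)) :
  (forall X Y W,
    (delta T Y W ⊗' idm (cz Z X)) ∘ chi Z X (Y ⊗ W) =
    (idm (T Y ⊗ T W) ⊗' m X) ∘ assoc _ _ _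
      ∘ (idm (T Y) ⊗' chi Z (cz Z X) W) ∘ assoc' _ _ _ ∘ (chi Z X Y ⊗' idm W)
      ∘ assoc _ _ _) ->
  forall X, m X = centraliser_mu X.
Proof.
move=> mE X; apply: chi_ext => W; apply: chi_ext2 => Y; apply: emb_inj; norm.
whisk (@unit C) (@unit C) (esym (mE X Y W)).
by whisk (@unit C) (@unit C) (centraliser_muE X Y W).
Qed.

Lemma centraliser_eta_nat (X X' : C) (f : hom X X') :
  cz_map Z f ∘ centraliser_eta X = centraliser_eta X' ∘ f.
Proof.
apply: emb_inj; rewrite /centraliser_eta -!lock; norm.
slideV (epsilon T) (cz_map Z f).
whisk (@unit C) (@unit C) (chi_natl Z f unit).
by [].
Qed.

Lemma centraliser_mu_nat (X X' : C) (f : hom X X') :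
  cz_map Z f ∘ centraliser_mu X = centraliser_mu X' ∘ cz_map Z (cz_map Z f).
Proof.
apply: chi_ext => W; apply: chi_ext2 => Y; apply: emb_inj; norm.
whisk (@unit C) (@unit C) (esym (centraliser_muE X Y W)).
slideV (delta T Y W) (cz_map Z f).
whisk (@unit C) (@unit C) (chi_natl Z f (Y ⊗ W)).
whisk (T Y) (@unit C) (chi_natl Z (cz_map Z f) W).
whisk (@unit C) W (chi_natl Z f Y).
by whisk (@unit C) (@unit C) (centraliser_muE X' Y W).
Qed.

Lemma centraliser_mu_eta_l (X : C) :
  centraliser_mu X ∘ centraliser_eta (cz Z X) = idm (cz Z X).
Proof.
apply: chi_ext => Y; apply: emb_inj; rewrite /centraliser_eta -lock; norm.
slideV (idm (T Y) ⊗' epsilon T) (centraliser_mu X).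
whisk (@unit C) (@unit C) (esym (centraliser_muE X Y unit)).
whisk (@unit C) (cz Z X) (delta_epsilon_r T Y).
by whisk (@unit C) (@unit C) (chi_natr Z X (runit Y)).
Qed.

Lemma centraliser_mu_eta_r (X : C) :
  centraliser_mu X ∘ cz_map Z (centraliser_eta X) = idm (cz Z X).
Proof.
apply: chi_ext => Y; apply: emb_inj; norm.
have E := chi_natl Z (centraliser_eta X) Y.
rewrite {2}/centraliser_eta -lock in E.
whisk (@unit C) (@unit C) E.
slideV (epsilon T) (chi Z (cz Z X) Y).
slideV (epsilon T) (idm (T Y) ⊗' centraliser_mu X).
whisk (@unit C) (@unit C) (esym (centraliser_muE X unit Y)).
whisk (@unit C) (cz Z X) (delta_epsilon_l T Y).
by whisk (@unit C) (@unit C) (chi_natr Z X (lunit Y)).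
Qed.

Lemma centraliser_mu_assoc (X : C) :
  centraliser_mu X ∘ centraliser_mu (cz Z X) =
  centraliser_mu X ∘ cz_map Z (centraliser_mu X).
Proof.
apply: chi_ext => W; apply: chi_ext2 => V.
apply: (eq_hom_epi (e := tensA (cz Z X) V W)); apply: chi_ext2 => U.
apply: emb_inj; norm.
whisk (T U) (@unit C) (esym (centraliser_muE (cz Z X) V W)).
slideV (idm (T U) ⊗' delta T V W) (centraliser_mu X).
whisk (@unit C) (@unit C) (esym (centraliser_muE X U (V ⊗ W))).
whisk (T U ⊗ T V) (@unit C) (chi_natl Z (centraliser_mu X) W).
whisk (@unit C) W (esym (centraliser_muE X U V)).
slideV (delta T U V) (chi Z (cz Z X) W).
slideV (delta T U V) (idm (T W) ⊗' centraliser_mu X).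
whisk (@unit C) (@unit C) (esym (centraliser_muE X (U ⊗ V) W)).
whisk (@unit C) (cz Z X) (delta_assoc T U V W).
by whisk (@unit C) (@unit C) (chi_natr Z X (assoc U V W)).
Qed.

Definition centraliser_monad : monad C :=
  @Monad C ZT centraliser_eta centraliser_mu centraliser_eta_nat
    centraliser_mu_nat centraliser_mu_eta_l centraliser_mu_eta_r
    centraliser_mu_assoc.

End CentraliserMonad.
End Centraliser.

Section Centres.
Variables (C : strict_monoidal) (R : rigid C).

Definition admits_central_Hopf_monad : Type := centralisable R (id_oplax C).
Definition admits_anticentral_comodule_monad : Type :=
  centralisable R (double_dual R).

(* Only the underlying monads: the Hopf structure of the first one and the
   coaction on the second one are left out. *)
Definition central_monad (D : admits_central_Hopf_monad) : monad C :=
  centraliser_monad D.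
Definition anticentral_monad (Q : admits_anticentral_comodule_monad) : monad C :=
  centraliser_monad Q.
End Centres.

(* Main.v *)
(* A monoidal transformation S -> T, composed with the universal coaction of
   Z_S, induces a monad morphism Z_T -> Z_S; hence a pivotal structure makes the
   two centralisers isomorphic.  Conversely, an algebra structure of Z_T on the
   unit object is the same as a monoidal transformation Id -> T.  The identity
   transformation makes the unit an algebra of the central monad; pulling it
   back along a monad morphism from the anti-central monad gives a monoidal
   transformation Id -> (-)^vv, which is invertible because C is rigid and
   (-)^vv is strong. *)
From Stdlib Require Import ClassicalEpsilon.
From mathcomp Require Import ssreflect ssrfun.
Require Import Defs.

Set Implicit Arguments.
Unset Strict Implicit.
Unset Printing Implicit Defensive.
Local Open Scope cat_scope.

(** * Invertibility of monoidal transformations *)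

Section MonoidalTransformations.
Variable C : strict_monoidal.

(** Lets [norm] erase the image under [T] of a structural identity. *)
Lemma fmap_eq_hom (T : functor C C) (a b : C) (e : a = b) :
  fmap T (eq_hom e) = eq_hom (f_equal T e).
Proof. by case: b / e; rewrite /= fmap_id. Qed.

Lemma inverse_monoidal (S T : oplax_functor C) (phi : nat_trans S T) :
  is_monoidal phi -> (forall X, is_iso (phi X)) ->
  exists psi : nat_trans T S, is_monoidal psi /\
    forall X, psi X ∘ phi X = idm (S X) /\ phi X ∘ psi X = idm (T X).
Proof.
move=> [phiD phiE] phi_iso.
(* [is_iso] only asserts existence, so the family of inverses is picked by choice. *)
pose psi X := proj1_sig (constructive_indefinite_description _ (phi_iso X)).
have psiK X : psi X ∘ phi X = idm _.
  by rewrite /psi; case: constructive_indefinite_description => ? [].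
have phiK X : phi X ∘ psi X = idm _.
  by rewrite /psi; case: constructive_indefinite_description => ? [].
have psiN a b (f : hom a b) : fmap S f ∘ psi a = psi b ∘ fmap T f.
  rewrite -[LHS]comp1l -(psiK b) -!compA; congr (_ ∘ _).
  by rewrite compA -nt_nat -compA phiK comp1r.
exists (NatTrans psiN); split=> //; split=> [X Y|] /=.
- rewrite -[LHS]comp1l -tensm_id -!psiK tensm_comp -!compA; congr (_ ∘ _).
  by rewrite compA -phiD -compA phiK comp1r.
- by rewrite -phiE -compA phiK comp1r.
Qed.

(* A strong monoidal functor preserves duals; [e] and [d] are the inverses of
   the structure maps used to transport the coevaluation and the evaluation. *)
Lemma strong_zigzag (T : oplax_functor C) (X X' : C) (p : dual_pair X X')
    (e : hom unit (T unit)) (d : hom (T X' ⊗ T X) (T (X' ⊗ X))) :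
  (forall Y Z, is_iso (delta T Y Z)) ->
  epsilon T ∘ e = idm unit -> d ∘ delta T X' X = idm _ ->
  runit (T X) ∘ (idm (T X) ⊗' (epsilon T ∘ fmap T (ev p) ∘ d)) ∘ assoc' _ _ _
    ∘ ((delta T X X' ∘ fmap T (coev p) ∘ e) ⊗' idm (T X)) ∘ lunit' (T X) = idm (T X).
Proof.
move=> delta_iso eK dK.
case: (delta_iso (X ⊗ X') X) => d1 [d1K Kd1]; case: (delta_iso unit X) => d2 [d2K Kd2].
(* [N1] to [N5] move the structure maps past the images under [T] until they cancel. What remains is
   [T] applied to the zigzag of [p], which is [N6]. *)
have N1 : d1 ∘ (fmap T (coev p) ⊗' idm (T X)) = fmap T (coev p ⊗' idm X) ∘ d2.
  have := delta_nat T (coev p) (idm X); rewrite fmap_id => E.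
  rewrite -[LHS]comp1r -Kd2 -!compA [_ ∘ (_ ∘ d2)]compA -E.
  by rewrite -!compA [d1 ∘ _]compA d1K comp1l.
have N2 : d2 ∘ (e ⊗' idm (T X)) = fmap T (lunit' X) ∘ lunit (T X).
  have E := delta_epsilon_l T X; rewrite {2}/lunit fmap_eq_hom in E.
  have D2 : lunit (T X) ∘ (epsilon T ⊗' idm (T X)) = eq_hom (f_equal T (tens1l X)) ∘ d2.
    by rewrite -E -compA Kd2 comp1r.
  rewrite /lunit' fmap_eq_hom; apply: emb_inj; norm.
  have D2' := f_equal (@emb _ _ _) D2; norm_in D2'; rewrite -D2'.
  by whisk (@unit C) (T X) eK.
have N3 : (idm (T X) ⊗' fmap T (ev p)) ∘ delta T X (X' ⊗ X) =
    delta T X unit ∘ fmap T (idm X ⊗' ev p).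
  by have := delta_nat T (idm X) (ev p); rewrite fmap_id.
have N4 : (idm (T X) ⊗' d) ∘ assoc' _ _ _ ∘ (delta T X X' ⊗' idm (T X)) =
    delta T X (X' ⊗ X) ∘ fmap T (assoc' _ _ _) ∘ d1.
  have E := delta_assoc T X X' X; rewrite {2}/assoc fmap_eq_hom in E.
  rewrite /assoc' fmap_eq_hom -[LHS]comp1r -Kd1; apply: emb_inj; norm.
  whisk (@unit C) (@unit C) (esym E).
  whisk (T X) (@unit C) dK.
  by idl.
have N5 := delta_epsilon_r T X.
have N6 := f_equal (fmap T) (zigzagl p); rewrite !fmap_comp fmap_id in N6.
rewrite /runit /assoc' /lunit' !fmap_eq_hom in N2 N4 N5 N6 *.
apply: emb_inj; norm.
whisk (@unit C) (@unit C) N4.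
whisk (@unit C) (@unit C) N1.
whisk (@unit C) (@unit C) N2.
whisk (@unit C) (@unit C) N3.
whisk (@unit C) (@unit C) N5.
idl.
whisk (@unit C) (@unit C) N6.
by idl.
Qed.

(* The inverse of [phi X] is the mate of [phi X'], with [X'] dual to [X]. *)
Lemma monoidal_to_strong_iso (R : rigid C) (T : oplax_functor C)
    (phi : nat_trans (id_oplax C) T) :
  is_strong T -> is_monoidal phi -> forall X, is_iso (phi X).
Proof.
move=> [delta_iso [e [eK Ke]]] [/= phiD phiE] X.
have {}phiD Y Z : delta T Y Z ∘ phi (Y ⊗ Z) = phi Y ⊗' phi Z.
  by rewrite phiD comp1r.
have phiN (a b : C) (f : hom a b) : fmap T f ∘ phi a = phi b ∘ f := nt_nat phi f.
move: (nt phi : forall a : C, hom a (T a)) phiD phiE phiN => {}phi phiD phiE phiN.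
pose X' := ldual R X; pose p : dual_pair X X' := ldual_pair R X.
have [d [dK _]] := delta_iso X' X.
have zz := strong_zigzag p delta_iso Ke dK.
have phi1 : phi unit = e by rewrite -[phi unit]comp1l -eK -compA phiE comp1r.
(* [betaE] and [alphaE]: [phi] carries the duality [p] to the one transported to [T X] and
   [T X']. *)
have betaE : (epsilon T ∘ fmap T (ev p) ∘ d) ∘ (phi X' ⊗' phi X) = ev p.
  rewrite -phiD -!compA [d ∘ _]compA dK comp1l phiN compA phiE.
  exact: comp1l.
have alphaE : (phi X ⊗' phi X') ∘ coev p = delta T X X' ∘ fmap T (coev p) ∘ e.
  by rewrite -phi1 -[RHS]compA phiN compA phiD.
rewrite -alphaE in zz.
move: (epsilon T ∘ fmap T (ev p) ∘ d) betaE zz => beta.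
rewrite tensm_split => betaE; rewrite (tensm_split' (phi X)) => zz.
exists (runit X ∘ (idm X ⊗' beta) ∘ (idm X ⊗' (phi X' ⊗' idm (T X)))
  ∘ assoc' X X' (T X) ∘ (coev p ⊗' idm (T X)) ∘ lunit' (T X)); split.
(* In this order [betaE] leaves the zigzag of [p]; in the other order the transported zigzag [zz]
   appears. *)
- apply: emb_inj; norm.
  slide (coev p) (phi X).
  whisk X (@unit C) betaE.
  by whisk (@unit C) (@unit C) (zigzagl p).
- rewrite -[RHS]zz.
  apply: emb_inj; norm.
  slide (phi X) beta.
  by slide (phi X) (phi X' ⊗' idm (T X)).
Qed.

End MonoidalTransformations.

Section Centralisers.
Variables (C : strict_monoidal) (R : rigid C).

(** * Monad morphisms between centralisers *)

Section Comparison.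
Variables (S T : oplax_functor C) (ZS : centralisable R S) (ZT : centralisable R T).
Variables (phi : nat_trans S T).

Definition comparison_aux (X Y : C) : hom (X ⊗ Y) (T Y ⊗ cz ZS X) :=
  (phi Y ⊗' idm (cz ZS X)) ∘ chi ZS X Y.

Lemma comparison_auxP (X : C) : coaction_natural (comparison_aux X).
Proof.
move=> Y Y' f; rewrite /comparison_aux compA -tensm_idr nt_nat tensm_idr.
by rewrite -!compA chi_natr.
Qed.

Definition comparison (X : C) : hom (cz ZT X) (cz ZS X) :=
  lift ZT (comparison_auxP X).

Lemma chi_comparison (X Y : C) :
  (idm (T Y) ⊗' comparison X) ∘ chi ZT X Y = (phi Y ⊗' idm _) ∘ chi ZS X Y.
Proof. exact: chi_lift. Qed.

Lemma comparison_nat (X X' : C) (f : hom X X') :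
  cz_map ZS f ∘ comparison X = comparison X' ∘ cz_map ZT f.
Proof.
apply: chi_ext => Y; apply: emb_inj; norm.
whisk (@unit C) (@unit C) (chi_comparison X Y).
slideV (phi Y) (cz_map ZS f).
whisk (@unit C) (@unit C) (chi_natl ZS f Y).
whisk (@unit C) (@unit C) (chi_natl ZT f Y).
by whisk (@unit C) (@unit C) (chi_comparison X' Y).
Qed.

Hypothesis phi_monoidal : is_monoidal phi.

Lemma comparison_eta (X : C) :
  comparison X ∘ centraliser_eta ZT X = centraliser_eta ZS X.
Proof.
case: phi_monoidal => _ phiE.
apply: emb_inj; rewrite /centraliser_eta -!lock; norm.
slideV (epsilon T) (comparison X).
whisk (@unit C) (@unit C) (chi_comparison X unit).
by whisk (@unit C) (cz ZS X) phiE.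
Qed.

(** Tested against the coaction in two variables, the defining equations of both multiplications
    reduce this to the compatibility of [phi] with [delta]. *)
Lemma comparison_mu (X : C) :
  comparison X ∘ centraliser_mu ZT X =
  centraliser_mu ZS X ∘ (comparison (cz ZS X) ∘ cz_map ZT (comparison X)).
Proof.
case: phi_monoidal => phiD _.
(* Writing [phi Y ⊗' phi W] as a composite lets each factor slide separately. *)
have {}phiD Y W := etrans (phiD Y W)
  (f_equal (fun k => k ∘ delta S Y W) (tensm_split (phi Y) (phi W))).
apply: chi_ext => W; apply: chi_ext2 => Y; apply: emb_inj; norm.
whisk (@unit C) (@unit C) (esym (centraliser_muE ZT X Y W)).
slideV (delta T Y W) (comparison X).
whisk (@unit C) (@unit C) (chi_comparison X (Y ⊗ W)).
whisk (@unit C) (cz ZS X) (phiD Y W).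
whisk (@unit C) (@unit C) (centraliser_muE ZS X Y W).
whisk (T Y) (@unit C) (chi_natl ZT (comparison X) W).
whisk (T Y) (@unit C) (chi_comparison (cz ZS X) W).
whisk (@unit C) W (chi_comparison X Y).
slideV (phi Y) (chi ZS (cz ZS X) W).
slideV (phi Y) (phi W ⊗' idm (cz ZS (cz ZS X))).
slideV (phi Y) (idm (T W) ⊗' centraliser_mu ZS X).
by slide (idm (S Y) ⊗' phi W) (centraliser_mu ZS X).
Qed.

Definition comparison_morphism :
    monad_morphism (centraliser_monad ZT) (centraliser_monad ZS) :=
  @MonadMorphism C (centraliser_monad ZT) (centraliser_monad ZS)
    (@NatTrans C C (centraliser_monad ZT) (centraliser_monad ZS)
      comparison comparison_nat)
    comparison_eta comparison_mu.

End Comparison.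

(** The comparison is contravariant in the transformation, so this composite is the one induced by
    [phi Y ∘ psi Y]. *)
Lemma comparisonK (S T : oplax_functor C) (ZS : centralisable R S)
    (ZT : centralisable R T) (phi : nat_trans S T) (psi : nat_trans T S) :
  (forall Y, phi Y ∘ psi Y = idm (T Y)) ->
  forall X, comparison ZT ZS psi X ∘ comparison ZS ZT phi X = idm (cz ZT X).
Proof.
move=> phiK X; apply: chi_ext => Y.
apply: emb_inj; norm.
whisk (@unit C) (@unit C) (chi_comparison ZS ZT phi X Y).
slideV (phi Y) (comparison ZT ZS psi X).
whisk (@unit C) (@unit C) (chi_comparison ZT ZS psi X Y).
whisk (@unit C) (cz ZT X) (phiK Y).
by idl.
Qed.

Lemma centralisers_isomorphic (S T : oplax_functor C) (ZS : centralisable R S)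
    (ZT : centralisable R T) (phi : nat_trans S T) :
  is_monoidal phi -> (forall X, is_iso (phi X)) ->
  monad_isomorphic (centraliser_monad ZS) (centraliser_monad ZT).
Proof.
move=> phi_monoidal phi_iso.
have [psi [psi_monoidal psiK]] := inverse_monoidal phi_monoidal phi_iso.
(* By contravariance, the morphism out of the centraliser of [S] comes from the inverse [psi]. *)
exists (comparison_morphism ZT ZS psi_monoidal), (comparison_morphism ZS ZT phi_monoidal).
by move=> X; split; apply: comparisonK => Y; case: (psiK Y).
Qed.

(** * Algebras on the unit object and monoidal transformations *)

Definition is_algebra (M : monad C) (a : C) (h : hom (M a) a) : Prop :=
  h ∘ eta M a = idm a /\ h ∘ mu M a = h ∘ fmap M h.

(** Restriction of scalars; associativity also uses naturality of [f] at [h]. *)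
Lemma algebra_pullback (M N : monad C) (f : monad_morphism M N) (a : C)
    (h : hom (N a) a) :
  is_algebra h -> is_algebra (M := M) (h ∘ f a).
Proof.
move=> [hE hM]; split; first by rewrite -compA mm_eta.
rewrite -compA mm_mu !compA hM fmap_comp !compA; congr (_ ∘ _).
by rewrite -!compA (nt_nat f).
Qed.

Section UnitAlgebras.
Variables (T : oplax_functor C) (Z : centralisable R T).

Section AlgebraOfTransformation.
Variable phi : forall Y : C, hom Y (T Y).
Hypotheses (phi_nat : forall (Y Y' : C) (f : hom Y Y'), fmap T f ∘ phi Y = phi Y' ∘ f)
  (phi_delta : forall Y W, delta T Y W ∘ phi (Y ⊗ W) = phi Y ⊗' phi W)
  (phi_epsilon : epsilon T ∘ phi unit = idm unit).

(** For [X = M = unit], a natural coaction is, up to structural identities, a natural transformation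
    from the identity to [T]. *)
Lemma algebra_of_aux_natural :
  coaction_natural (X := unit) (M := unit)
    (fun Y => runit' (T Y) ∘ phi Y ∘ lunit Y).
Proof.
move=> Y Y' f; apply: emb_inj; norm.
whisk (@unit C) (@unit C) (phi_nat f).
by [].
Qed.

Definition algebra_of : hom (cz Z unit) unit := lift Z algebra_of_aux_natural.

Lemma chi_algebra_of Y :
  (idm (T Y) ⊗' algebra_of) ∘ chi Z unit Y = runit' (T Y) ∘ phi Y ∘ lunit Y.
Proof. exact: chi_lift. Qed.

(** The unit law comes from [phi_epsilon], associativity from [phi_delta]. *)
Lemma algebra_ofP : is_algebra (M := centraliser_monad Z) algebra_of.
Proof.
have phiD Y W := etrans (phi_delta Y W) (tensm_split (phi Y) (phi W)).
split.
- apply: emb_inj; rewrite /= /centraliser_eta -lock; norm.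
  slideV (epsilon T) algebra_of.
  whisk (@unit C) (@unit C) (chi_algebra_of unit).
  by whisk (@unit C) (@unit C) phi_epsilon.
- rewrite /=; apply: chi_ext => W; apply: chi_ext2 => Y; apply: emb_inj; norm.
  whisk (@unit C) (@unit C) (esym (centraliser_muE Z unit Y W)).
  slideV (delta T Y W) algebra_of.
  whisk (@unit C) (@unit C) (chi_algebra_of (Y ⊗ W)).
  whisk (@unit C) (@unit C) (phiD Y W).
  whisk (T Y) (@unit C) (chi_natl Z algebra_of W).
  whisk (T Y) (@unit C) (chi_algebra_of W).
  whisk (@unit C) W (chi_algebra_of Y).
  by slideV (phi Y) (phi W).
Qed.
End AlgebraOfTransformation.

Section TransformationOfAlgebra.
Variable h : hom (cz Z unit) unit.
Hypothesis hP : is_algebra (M := centraliser_monad Z) h.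

(** Undoes [algebra_of]: this solves the equation [chi_algebra_of] for [phi Y]. *)
Definition transformation_of (Y : C) : hom Y (T Y) :=
  runit (T Y) ∘ (idm (T Y) ⊗' h) ∘ chi Z unit Y ∘ lunit' Y.

Lemma transformation_of_nat (Y Y' : C) (f : hom Y Y') :
  fmap T f ∘ transformation_of Y = transformation_of Y' ∘ f.
Proof.
apply: emb_inj; rewrite /transformation_of; norm.
slide (fmap T f) h.
by whisk (@unit C) (@unit C) (chi_natr Z unit f).
Qed.

Definition transformation : nat_trans (id_oplax C) T :=
  @NatTrans C C (id_oplax C) T transformation_of transformation_of_nat.

(** Through [centraliser_muE], the associativity law of [h] becomes compatibility with [delta]; its
    unit law is compatibility with [epsilon]. *)
Lemma transformationP : is_monoidal transformation.
Proof.
case: hP => /= hE hM; split=> [Y W|].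
- rewrite [RHS]comp1r /= (tensm_split' (transformation_of Y)).
  apply: emb_inj; rewrite /transformation_of; norm.
  slide (delta T Y W) h.
  whisk (@unit C) (@unit C) (centraliser_muE Z unit Y W).
  whisk (T Y ⊗ T W) (@unit C) hM.
  whisk (T Y) (@unit C) (chi_natl Z h W).
  by [].
- rewrite /= -[RHS]hE; apply: emb_inj; rewrite /transformation_of /centraliser_eta -lock; norm.
  by slide (epsilon T) h.
Qed.
End TransformationOfAlgebra.
End UnitAlgebras.
End Centralisers.

(** * Pivotality and the central and anti-central monads *)

Theorem corollary6p27 (C : strict_monoidal) (R : rigid C)
    (D : admits_central_Hopf_monad R) (Q : admits_anticentral_comodule_monad R) :
  pivotal R <-> monad_isomorphic (central_monad D) (anticentral_monad Q).
Proof.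
split=> [[phi [phi_monoidal phi_iso]]|[_ [g _]]].
  exact: centralisers_isomorphic phi_monoidal phi_iso.
have idN (Y Y' : C) (f : hom Y Y') : fmap (id_oplax C) f ∘ idm Y = idm Y' ∘ f.
  by rewrite comp1l comp1r.
have aP : is_algebra (M := central_monad D) (algebra_of (T := id_oplax C) D idN).
  by apply: algebra_ofP => [Y W|] /=; rewrite ?tensm_id comp1l.
have hP := algebra_pullback g aP.
have psiP := transformationP (T := double_dual R) hP.
eexists; split; first exact: psiP.
exact: monoidal_to_strong_iso (double_dual_strong R) psiP.
Qed.
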